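(* Let $\mathcal{W}=\{\mathbb{R}^d; f_1,\dots,f_N; p_1,\dots,p_N\}$ be a weighted IFS, $N\ge 2$, with $p_i>0$, $\sum_i p_i=1$, such that each $f_i$ satisfies $$s_i\|x-y\|\le \|f_i(x)-f_i(y)\|\le c_i\|x-y\|\quad\text{for all }x,y\in\mathbb{R}^d,$$ where $0<s_i\le c_i<1$. Let $\mu$ be the invariant Borel probability measure of $\mathcal{W}$, and assume that $\mathcal{W}$ satisfies the strong open set condition. Then for every $r\in(0,\infty)$, $$k_r\le \underline{D}_r(\mu)\le \overline{D}_r(\mu)\le l_r,$$ where $k_r,l_r\in(0,\infty)$ are the unique numbers with $\sum_{i=1}^N (p_i s_i^r)^{\frac{k_r}{r+k_r}}=1$ and $\sum_{i=1}^N (p_i c_i^r)^{\frac{l_r}{r+l_r}}=1$.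
   Context: $\|\cdot\|$ is the Euclidean norm. The invariant measure of a weighted IFS $\{\mathbb{R}^d;f_1,\dots,f_N;p_1,\dots,p_N\}$ (contractions $f_i$, probability vector $(p_i)$ with all $p_i>0$) is the unique Borel probability measure $\mu$ with $\mu=\sum_{i=1}^N p_i\,\mu\circ f_i^{-1}$; it is supported on the attractor $A$, the unique nonempty compact set with $A=\bigcup_i f_i(A)$. The IFS satisfies the strong open set condition (SOSC) if there is a nonempty open set $U$ with $f_i(U)\subset U$ for all $i$, $f_i(U)\cap f_j(U)=\emptyset$ for $i\ne j$, and $U\cap A\neq\emptyset$. For a Borel probability measure $\mu$ on $\mathbb{R}^d$, $r\in(0,\infty)$, $n\in\mathbb{N}$: $V_{n,r}(\mu)=\inf\{\int \operatorname{dist}(x,B)^r\,d\mu(x): B\subset\mathbb{R}^d,\ \operatorname{card}(B)\le n\}$, $e_{n,r}(\mu)=V_{n,r}(\mu)^{1/r}$, and the lower/upper quantization dimensions of order $r$ are $\underline{D}_r(\mu)=\liminf_{n\to\infty}\frac{\log n}{-\log e_{n,r}(\mu)}$, $\overline{D}_r(\mu)=\limsup_{n\to\infty}\frac{\log n}{-\log e_{n,r}(\mu)}$. *)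

(* Defs.v *)
From HB Require Import structures.
From mathcomp Require Import all_boot all_order all_algebra.
From mathcomp Require Import all_classical all_reals all_analysis.
Set Implicit Arguments. Unset Strict Implicit. Unset Printing Implicit Defensive.
Import Order.TTheory GRing.Theory Num.Theory.
Import numFieldNormedType.Exports.
Local Open Scope classical_set_scope.
Local Open Scope ring_scope.

(* R^d as row vectors; Euclidean norm (the library norm on 'rV is the max norm). *)
Definition enorm (R : realType) (d : nat) (x : 'rV[R]_d) : R :=
  Num.sqrt (\sum_(i < d) x ord0 i ^+ 2).

(* Borel sigma-algebra on R^d: generated by the open sets (the matrix
   topology on 'rV[R]_d is the product = Euclidean topology). *)
Definition Rd (R : realType) (d : nat) := g_sigma_algebraType (@open 'rV[R]_d).

Definition distB (R : realType) (d : nat) (x : 'rV[R]_d) (B : seq 'rV[R]_d) : R :=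
  \big[Order.min/enorm (x - head 0 B)]_(b <- B) enorm (x - b).

(* n-th quantization error of order r: V_{n,r}(mu).  Sets B with card B = 0
   give dist = +oo, hence never matter for the infimum when n >= 1. *)
Definition Vnr (R : realType) (d : nat) (mu : probability (Rd R d) R)
    (n : nat) (r : R) : \bar R :=
  ereal_inf [set (\int[mu]_x ((powR (distB x B) r)%:E))%E
            | B in [set B : seq 'rV[R]_d | (0 < size B <= n)%N]].

(* e_{n,r}(mu) = V_{n,r}(mu)^{1/r} (V is finite for compactly supported mu) *)
Definition enr (R : realType) (d : nat) (mu : probability (Rd R d) R)
    (n : nat) (r : R) : R :=
  powR (fine (Vnr mu n r)) r^-1.

Definition quant_dim_lower (R : realType) (d : nat) (mu : probability (Rd R d) R)
    (r : R) : \bar R :=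
  limn_einf (fun n : nat => ((ln (n%:R : R)) / (- ln (enr mu n r)))%:E).

Definition quant_dim_upper (R : realType) (d : nat) (mu : probability (Rd R d) R)
    (r : R) : \bar R :=
  limn_esup (fun n : nat => ((ln (n%:R : R)) / (- ln (enr mu n r)))%:E).

Definition is_attractor (R : realType) (d N : nat)
    (f : 'I_N -> 'rV[R]_d -> 'rV[R]_d) (A : set 'rV[R]_d) : Prop :=
  A !=set0 /\ compact A /\ A = \bigcup_(i in [set: 'I_N]) (f i @` A).

Definition is_invariant_measure (R : realType) (d N : nat)
    (f : 'I_N -> 'rV[R]_d -> 'rV[R]_d) (p : 'I_N -> R)
    (mu : probability (Rd R d) R) : Prop :=
  forall E : set (Rd R d), measurable E ->
    mu E = (\sum_(i < N) (p i)%:E * mu (f i @^-1` E))%E.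

Definition SOSC (R : realType) (d N : nat)
    (f : 'I_N -> 'rV[R]_d -> 'rV[R]_d) (A : set 'rV[R]_d) : Prop :=
  exists U : set 'rV[R]_d,
    [/\ open U, U !=set0,
        (forall i, f i @` U `<=` U),
        (forall i j, i != j -> f i @` U `&` f j @` U = set0)
      & U `&` A !=set0].

(* Main.v *)
(* Upper bound: the error obeys V(n) <= sum_i p_i c_i^r V(n_i) for sum_i n_i <= n,
   so placing a share q_i = (p_i c_i^r)^(l/(r+l)) of the points in f_i(A) gives
   V(n) = O(n^(-r/l)).

   Lower bound: fix k' < k.  By the strong open set condition some word tau has
   f_tau(A) inside the open set U, so the compact sets f_w(f_tau(A)), w of length m,
   are pairwise disjoint, hence at positive mutual distance; compactness thus
   provides a separation for which openness of f_i(U) would require invariance of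
   domain.  For m large the maps f_w o f_tau satisfy sum (P_w S_w^r)^(k'/(r+k')) >= 1.
   Iterating them yields about 2n cells of A, each of mass M and separated from the
   others by a radius rho with M rho^r at least of order n^(-(r+k')/k').  A set of n
   points is close to at most n of the cells, so V(n) is at least of order n^(-r/k').

   Both recursions run over a real scale x: the i-th map is applied to a solution
   for scale q_i x, which replaces the usual stopping-time antichains of words. *)
Require Import Defs.
From HB Require Import structures.
From mathcomp Require Import all_boot all_order all_algebra.
From mathcomp Require Import all_classical all_reals all_analysis.
From mathcomp Require Import measurable_realfun ring lra.
Set Implicit Arguments.
Unset Strict Implicit.
Unset Printing Implicit Defensive.
Import Order.TTheory GRing.Theory Num.Theory.
Import numFieldNormedType.Exports.
Local Open Scope classical_set_scope.
Local Open Scope ring_scope.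

(** * Real powers, finite products and induction on a real scale *)

Lemma powR_homo_le (R : realType) (r x y : R) :
  0 <= r -> 0 <= x -> x <= y -> x `^ r <= y `^ r.
Proof.
by move=> r0 x0 xy; apply: ge0_ler_powR => //; rewrite nnegrE// (le_trans x0).
Qed.

Lemma powR_lt1 (R : realType) (r x : R) : 0 < r -> 0 <= x -> x < 1 -> x `^ r < 1.
Proof.
move=> r0 x0 x1; rewrite -[X in _ < X](_ : 1 `^ r = 1); last by rewrite powR1.
by apply: gt0_ltr_powR; rewrite ?nnegrE.
Qed.

Lemma exists_expr_lt (R : realType) (q e : R) : 0 <= q -> q < 1 -> 0 < e ->
  exists n, q ^+ n < e.
Proof.
move=> q0 q1 e0; have /(@cvg_expr R) : `|q| < 1 by rewrite ger0_norm.
move=> /cvgr0_norm_lt/(_ _ e0)[n _ /(_ n (leqnn _))] /= qn; exists n.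
exact: le_lt_trans (ler_norm _) qn.
Qed.

(** Each step shrinks the scale by the factor [q < 1], so ordinary induction on an [n] with
    [q ^+ n * x <= 1] suffices. The cutoff [x0] keeps scales away from 0: in the applications a
    ratio is at least [x0] and the step has [1 < x], so the smaller scale is still at least [x0]. *)
Lemma scale_induction (R : realType) (P : R -> Prop) (x0 q : R) :
  0 <= q < 1 ->
  (forall x, x0 <= x -> x <= 1 -> P x) ->
  (forall x, x0 <= x -> 1 < x ->
    (forall y, x0 <= y -> y <= q * x -> P y) -> P x) ->
  forall x, x0 <= x -> P x.
Proof.
move=> /andP[q0 q1] Pbase Pstep.
have main n : forall x, x0 <= x -> q ^+ n * x <= 1 -> P x.
  elim: n => [x x0x|n IH x x0x xn]; first by rewrite expr0 mul1r; exact: Pbase.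
  have [/Pbase|x1] := leP x 1; first exact.
  apply: Pstep => // y x0y yx; apply: IH => //; apply: le_trans xn.
  by rewrite exprSr -mulrA ler_wpM2l ?exprn_ge0.
move=> x x0x; have [/Pbase|x1] := leP x 1; first exact.
have x_gt0 : 0 < x := lt_trans ltr01 x1.
have [|n xn] := @exists_expr_lt _ _ x^-1 q0 q1; first by rewrite invr_gt0.
by apply: (main n) => //; rewrite -ler_pdivlMr// div1r ltW.
Qed.

Lemma le_bigmin_seq (R : realType) (T : Type) (F : T -> R) (s : seq T) (t m : R) :
  (t <= \big[Order.min/m]_(b <- s) F b) = (t <= m) && all (fun b => t <= F b) s.
Proof.
elim: s => [|b s IH]; first by rewrite big_nil andbT.
by rewrite big_cons le_min IH/= andbCA.
Qed.

Lemma exists_common_ratio (R : realType) (I : finType) (c : I -> R) :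
  (forall i, c i < 1) -> exists2 q : R, 0 < q < 1 & forall i, c i <= q.
Proof.
(* The default 1/2 keeps the maximum strictly between 0 and 1 whatever the [c i] are, even for an
   empty index type. *)
move=> c1; exists (\big[Order.max/2^-1]_i c i); last first.
  by move=> i; exact: (le_bigmax_cond _ c).
apply/andP; split.
  by apply: lt_le_trans (bigmax_ge_id _ _ _ _); rewrite invr_gt0.
by apply/bigmax_ltP; split => //; rewrite invf_lt1 ?ltr1n.
Qed.

Lemma exists_common_lower_bound (R : realType) (I : finType) (c : I -> R) :
  (forall i, 0 < c i) -> exists2 q : R, 0 < q <= 1 & forall i, q <= c i.
Proof.
move=> c0; exists (\big[Order.min/1]_i c i); last first.
  by move=> i; exact: (bigmin_le_cond _ c).
by rewrite bigmin_le_id andbT; apply: lt_bigmin.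
Qed.

Lemma sum_neq0_index (R : realType) (I : finType) (a : I -> R) :
  \sum_i a i != 0 -> exists i : I, True.
Proof.
move=> sum_neq0; apply: contrapT => /forallNP no_i.
by move: sum_neq0; rewrite big1 ?eqxx// => i; have := no_i i.
Qed.

(** Distributivity expands the power into one product per function from ['I_n] to [I]; the
    reindexing identifies these functions with words of length [n]. *)
Lemma sum_tuple_prod (R : realType) (I : finType) (n : nat) (a : I -> R) :
  \sum_(w : n.-tuple I) \prod_(i <- w) a i = (\sum_i a i) ^+ n.
Proof.
rewrite -[in RHS](card_ord n) -prodr_const bigA_distr_bigA /=.
rewrite (reindex (fun w : n.-tuple I => [ffun i => tnth w i])) /=.
  by apply: eq_bigr => w _; rewrite big_tuple; apply: eq_bigr => i _; rewrite ffunE.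
exists (fun h : {ffun 'I_n -> I} => [tuple h i | i < n]) => [w _|h _].
  by apply: eq_from_tnth => i; rewrite tnth_mktuple ffunE.
by apply/ffunP => i; rewrite ffunE tnth_mktuple.
Qed.

Lemma prod_powR (R : realType) (I : Type) (w : seq I) (a : I -> R) (t : R) :
  (forall i, 0 < a i) ->
  \prod_(i <- w) a i `^ t = (\prod_(i <- w) a i) `^ t.
Proof.
move=> a0; elim: w => [|i w IH]; first by rewrite !big_nil powR1.
by rewrite !big_cons IH powRM ?(ltW (a0 i))// prodr_ge0// => j _; exact: ltW.
Qed.

Lemma prod_lt1 (R : realType) (I : Type) (w : seq I) (a : I -> R) :
  (forall i, 0 < a i < 1) ->
  (0 < size w)%N -> \prod_(i <- w) a i < 1.
Proof.
move=> a01; case: w => // i w _; rewrite big_cons; have /andP[ai0 ai1] := a01 i.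
apply: le_lt_trans ai1; rewrite ler_piMr ?(ltW ai0)//.
elim/big_rec: _ => // j x _ x1; have /andP[aj0 aj1] := a01 j.
by apply: le_trans (ltW aj1); rewrite ler_piMr// ltW.
Qed.

(** * Euclidean norm and Borel sets *)

Section EuclideanNorm.
Context {R : realType} {d : nat}.
Implicit Types (x y z : 'rV[R]_d).

Lemma enorm_ge0 x : 0 <= enorm x.
Proof. exact: sqrtr_ge0. Qed.

Lemma enorm0 : enorm (0 : 'rV[R]_d) = 0.
Proof.
rewrite /enorm big1 ?sqrtr0// => i _.
by rewrite mxE expr0n.
Qed.

Lemma enormN x : enorm (- x) = enorm x.
Proof. by congr Num.sqrt; apply: eq_bigr => i _; rewrite mxE sqrrN. Qed.

Lemma enormBC x y : enorm (x - y) = enorm (y - x).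
Proof. by rewrite -enormN opprB. Qed.

Lemma sum_sqr_ge0 (u : 'I_d -> R) : 0 <= \sum_i u i ^+ 2.
Proof. by apply: sumr_ge0 => i _; exact: sqr_ge0. Qed.

(** The quadratic polynomial [\sum_i (u i * t + v i) ^+ 2] in [t] is nonnegative; its value at the
    minimiser [- b / a] gives the inequality. If [a = 0], then every [u i] vanishes. *)
Lemma cauchy_schwarz (u v : 'I_d -> R) :
  (\sum_i u i * v i) ^+ 2 <= (\sum_i u i ^+ 2) * (\sum_i v i ^+ 2).
Proof.
set a := \sum_i u i ^+ 2; set b := \sum_i u i * v i; set e := \sum_i v i ^+ 2.
have quad t : 0 <= a * t ^+ 2 + b * t *+ 2 + e.
  suff -> : a * t ^+ 2 + b * t *+ 2 + e = \sum_i (u i * t + v i) ^+ 2.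
    exact: sum_sqr_ge0.
  rewrite /a /b /e !mulr_suml -sumrMnl -!big_split /=.
  by apply: eq_bigr => i _; ring.
have a0 : 0 <= a := sum_sqr_ge0 u.
have [a_eq0|a_neq0] := eqVneq a 0.
  have u0 i : u i = 0.
    have /eqP := a_eq0; rewrite psumr_eq0 => [|j _]; last exact: sqr_ge0.
    by move=> /allP/(_ i (mem_index_enum _)); rewrite sqrf_eq0 => /eqP.
  by rewrite /b big1 ?expr0n ?a_eq0 ?mul0r// => i _; rewrite u0 mul0r.
have {a_neq0}a0 : 0 < a by rewrite lt_neqAle eq_sym a_neq0.
have := mulr_ge0 (ltW a0) (quad (- b / a)).
suff -> : a * (a * (- b / a) ^+ 2 + b * (- b / a) *+ 2 + e) = a * e - b ^+ 2.
  by rewrite subr_ge0.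
by field; exact: lt0r_neq0.
Qed.

Lemma enorm_triangle x y : enorm (x + y) <= enorm x + enorm y.
Proof.
rewrite -(@ler_pXn2r _ 2) ?nnegrE ?addr_ge0 ?enorm_ge0//.
rewrite sqrrD /enorm !sqr_sqrtr ?sum_sqr_ge0//.
have -> : \sum_i (x + y) ord0 i ^+ 2 = \sum_i x ord0 i ^+ 2
   + (\sum_i x ord0 i * y ord0 i) *+ 2 + \sum_i y ord0 i ^+ 2.
  by rewrite -sumrMnl -!big_split /=; apply: eq_bigr => i _; rewrite mxE; ring.
rewrite lerD2r lerD2l lerMn2r /= -sqrtrM ?sum_sqr_ge0//.
apply: le_trans (ler_norm _) _.
rewrite -sqrtr_sqr; apply: ler_wsqrtr.
exact: cauchy_schwarz.
Qed.

Lemma enorm_triangleB x y z : enorm (x - z) <= enorm (x - y) + enorm (y - z).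
Proof. by rewrite -[x - z](subrKA y) enorm_triangle. Qed.

(** The max norm is attained at some coordinate. This is the direction that puts a Euclidean ball
    inside the max-norm ball of the same radius; that Euclidean balls are open comes from continuity
    of [enorm]. *)
Lemma norm_le_enorm x : `|x| <= enorm x.
Proof.
have [->|] := eqVneq x 0; first by rewrite normr0 enorm_ge0.
rewrite -normr_eq0 => /mx_norm_neq0[[i j] /=].
rewrite [i]ord1 => nx; rewrite [leLHS]nx.
rewrite -sqrtr_sqr; apply: ler_wsqrtr.
by rewrite (bigD1 j)//= lerDl; apply: sumr_ge0 => *; exact: sqr_ge0.
Qed.

Lemma continuous_enorm : continuous (@enorm R d).
Proof.
suff sq : continuous (fun x : 'rV[R]_d => \sum_i x ord0 i ^+ 2).
  by move=> x; exact: (continuous_comp (sq x) (@sqrt_continuous R _)).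
apply: (@continuous_big R _ (@GRing.add R) 0 xpredT add_continuous) => i _ x.
exact: (continuous_comp (@coord_continuous R 1 d ord0 i x) (@exprn_continuous R 2 _)).
Qed.

Lemma continuous_enormB y : continuous (fun x => enorm (x - y)).
Proof.
move=> x; apply: (@continuous_comp _ _ _ (fun x : 'rV[R]_d => x - y) (@enorm R d)).
  by apply: continuousB; [exact: (fun U => id)|exact: cst_continuous].
exact: continuous_enorm.
Qed.

Lemma open_enorm_ball y t : open [set x | enorm (x - y) < t].
Proof.
rewrite (_ : [set _ | _] = (fun x => enorm (x - y)) @^-1` [set u | u < t])//.
by apply: open_comp => [x _|]; [exact: continuous_enormB|exact: open_lt].
Qed.

Lemma enorm_ball_nbhs (U : set 'rV[R]_d) y : nbhs y U ->
  exists2 e, 0 < e & forall x, enorm (x - y) < e -> U x.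
Proof.
move=> /nbhs_ballP[e /= e0 yU]; exists e => // x xy; apply: yU.
rewrite -ball_normE /=; apply: le_lt_trans xy.
by rewrite distrC norm_le_enorm.
Qed.

Lemma enorm_lipschitz_continuous (g : 'rV[R]_d -> 'rV[R]_d) k : 0 < k ->
  (forall x y, enorm (g x - g y) <= k * enorm (x - y)) -> continuous g.
Proof.
move=> k0 gk x; apply/(@cvgrPdist_lt _ 'rV[R]_d _ (nbhs x) _ g (g x)) => e e0.
have : nbhs x [set y | enorm (y - x) < e / k].
  apply: open_nbhs_nbhs; split; first exact: open_enorm_ball.
  by rewrite /= subrr enorm0 divr_gt0.
apply: filterS => y /= ye; rewrite distrC.
apply: le_lt_trans (norm_le_enorm _) _; apply: le_lt_trans (gk _ _) _.
by rewrite mulrC -ltr_pdivlMr.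
Qed.

End EuclideanNorm.

Section Borel.
Context {R : realType} {d : nat}.

Lemma open_measurable_Rd (U : set 'rV[R]_d) : open U -> measurable (U : set (Rd R d)).
Proof. by move=> oU; exact: sub_sigma_algebra. Qed.

Lemma closed_measurable_Rd (C : set 'rV[R]_d) :
  closed C -> measurable (C : set (Rd R d)).
Proof.
move=> cC; rewrite -[C]setCK; apply: measurableC; apply: open_measurable_Rd.
exact: closed_openC.
Qed.

Lemma compact_closed_Rd (C : set 'rV[R]_d) : compact C -> closed C.
Proof. by apply: compact_closed; exact: norm_hausdorff. Qed.

Lemma compact_measurable_Rd (C : set 'rV[R]_d) :
  compact C -> measurable (C : set (Rd R d)).
Proof. by move=> /compact_closed_Rd; exact: closed_measurable_Rd. Qed.

Lemma continuous_measurable_Rd (g : 'rV[R]_d -> 'rV[R]_d) :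
  continuous g -> measurable_fun setT (g : Rd R d -> Rd R d).
Proof.
move=> /continuousP cg.
apply: (@measurability _ _ (Rd R d) (Rd R d) setT _ (@open 'rV[R]_d)) => [//|].
move=> _ [U oU <-].
by rewrite setTI; apply: open_measurable_Rd; exact: cg.
Qed.

Lemma continuous_measurable_real (g : 'rV[R]_d -> R) :
  continuous g -> measurable_fun setT (g : Rd R d -> R).
Proof.
move=> /continuousP cg; apply: (measurability _ (RGenOpens.measurableE R)).
move=> _ [_ [a [b ->] <-]]; rewrite setTI.
by apply: open_measurable_Rd; apply: cg; exact: interval_open.
Qed.

Lemma measurable_enormB (b : 'rV[R]_d) :
  measurable_fun setT (fun x : Rd R d => enorm (x - b) : R).
Proof. by apply: continuous_measurable_real; exact: continuous_enormB. Qed.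

Lemma measurable_distB (B : seq 'rV[R]_d) :
  measurable_fun setT (fun x : Rd R d => distB x B : R).
Proof.
(* The default point is made independent of [B] first, since [head 0 B] would change along the
   induction. *)
rewrite /distB; move: (head _ _) => b0; elim: B => [|b B IH].
  rewrite (_ : (fun _ => _) = fun x : Rd R d => enorm (x - b0) : R).
    exact: measurable_enormB.
  by apply/funext => x; rewrite big_nil.
rewrite (_ : (fun _ => _) = (fun x : Rd R d => Order.min (enorm (x - b))
    (\big[Order.min/enorm (x - b0)]_(b <- B) enorm (x - b)) : R)).
  by apply: measurable_minr => //; exact: measurable_enormB.
by apply/funext => x; rewrite big_cons.
Qed.

(** For nonempty [B] the default value of the minimum is the distance to an entry of [B], so it adds
    no condition. *)
Lemma distB_geP (x : 'rV[R]_d) (B : seq 'rV[R]_d) (t : R) : (0 < size B)%N ->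
  reflect (forall b, b \in B -> t <= enorm (x - b)) (t <= distB x B).
Proof.
case: B => // b0 B _; rewrite /distB le_bigmin_seq.
apply: (iffP andP) => [[_ /allP//]|tB]; split; first by rewrite tB ?mem_head.
exact/allP.
Qed.

Lemma distB_le (x : 'rV[R]_d) (B : seq 'rV[R]_d) b : b \in B ->
  distB x B <= enorm (x - b).
Proof. by case: B => // b0 B; move: b; exact/distB_geP. Qed.

Lemma distB_ge0 (x : 'rV[R]_d) (B : seq 'rV[R]_d) : (0 < size B)%N ->
  0 <= distB x B.
Proof. by move=> B0; apply/distB_geP => // b _; exact: enorm_ge0. Qed.

Lemma measurable_distB_powR (B : seq 'rV[R]_d) (r : R) :
  measurable_fun setT (fun x : Rd R d => (distB x B `^ r)%:E).
Proof.
apply/measurable_EFinP.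
exact: (measurableT_comp (@measurable_powR R r) (measurable_distB B)).
Qed.

End Borel.

(** * The invariant measure *)

Section InvariantMeasure.
Context {R : realType} {d N : nat} (f : 'I_N -> 'rV[R]_d -> 'rV[R]_d).
Context (p c : 'I_N -> R) (mu : probability (Rd R d) R).
Hypothesis p_gt0 : forall i, 0 < p i.
Hypothesis c_gt0 : forall i, 0 < c i.
Hypothesis f_lip : forall i x y, enorm (f i x - f i y) <= c i * enorm (x - y).
Hypothesis mu_inv : is_invariant_measure f p mu.

Lemma ifs_continuous i : continuous (f i).
Proof. apply: (enorm_lipschitz_continuous (c_gt0 i)); exact: f_lip. Qed.

Lemma ifs_measurable i : measurable_fun setT (f i : Rd R d -> Rd R d).
Proof. by apply: continuous_measurable_Rd; exact: ifs_continuous. Qed.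

(** Invariance presents [mu] as a finite sum of scaled pushforwards, and the integral is additive in
    the measure. *)
Lemma integral_invariant (h : Rd R d -> \bar R) :
  measurable_fun setT h -> (forall x, 0 <= h x)%E ->
  (\int[mu]_x h x = \sum_(i < N) (p i)%:E * \int[mu]_x h (f i x))%E.
Proof.
move=> mh h0.
(* Without indices, invariance would give the whole space measure 0. *)
have [N0|/card_gt0P[i0 _]] := posnP #|'I_N|.
  have := mu_inv measurableT; rewrite probability_setT big1 => [/eqP|i]; last first.
    by have := fintype0 i N0.
  by rewrite gt_eqF.
(* [msum] takes measures indexed by [nat]; [i0] fills the positions from [N] on, which do not enter
   [msum nu N]. *)
pose nu n := mscale (NngNum (ltW (p_gt0 (insubd i0 n))))
  (measure_function_pushforward__canonical__measure_function_Measure mu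
    (ifs_measurable (insubd i0 n))).
rewrite (eq_measure_integral (msum nu N)) => [|E mE _]; last first.
  apply: etrans (mu_inv mE) _; apply: eq_bigr => i _.
  by rewrite /= /mscale/= valKd.
rewrite ge0_integral_measure_sum//; apply: eq_bigr => i _.
rewrite ge0_integral_mscale//= valKd; congr (_ * _)%E.
by rewrite ge0_integral_pushforward//=; exact: ifs_measurable.
Qed.

Lemma invariant_image_ge i (C : set 'rV[R]_d) : compact C ->
  ((p i)%:E * mu C <= mu (f i @` C))%E.
Proof.
move=> cC; have cfC : compact (f i @` C).
  by apply: continuous_compact cC; apply: continuous_subspaceT; exact: ifs_continuous.
have mfC := compact_measurable_Rd cfC.
have mpre j : measurable (f j @^-1` (f i @` C) : set (Rd R d)).
  by rewrite -[X in measurable X]setTI; exact: ifs_measurable.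
rewrite [leRHS]mu_inv// (bigD1 i)//=; apply: le_trans (leeDl _ _); last first.
  by apply: sume_ge0 => j _; rewrite mule_ge0// lee_fin ltW.
rewrite lee_pmul2l ?lte_fin// ?ltry//; apply: le_measure; rewrite ?inE//.
  exact: compact_measurable_Rd.
by move=> x Cx; exists x.
Qed.

End InvariantMeasure.

(** * The invariant measure is carried by the attractor *)

Section Support.
Context {R : realType} {d N : nat} (f : 'I_N -> 'rV[R]_d -> 'rV[R]_d).
Context (p c : 'I_N -> R) (mu : probability (Rd R d) R) (A : set 'rV[R]_d).
Hypothesis p_gt0 : forall i, 0 < p i.
Hypothesis p_sum : \sum_i p i = 1.
Hypothesis c_gt0 : forall i, 0 < c i.
Hypothesis c_lt1 : forall i, c i < 1.
Hypothesis f_lip : forall i x y, enorm (f i x - f i y) <= c i * enorm (x - y).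
Hypothesis mu_inv : is_invariant_measure f p mu.
Hypothesis A_neq0 : A !=set0.
Hypothesis A_closed : closed A.
Hypothesis A_sub : forall i, f i @` A `<=` A.

Let nbd (t : R) : set 'rV[R]_d := [set x | exists2 a, A a & enorm (x - a) < t].

Let nbd_open t : open (nbd t).
Proof.
rewrite (_ : nbd t = \bigcup_(a in A) [set x | enorm (x - a) < t]) //.
by apply: bigcup_open => a _; exact: open_enorm_ball.
Qed.

Let mnbd t : measurable (nbd t : set (Rd R d)).
Proof. exact: open_measurable_Rd. Qed.

(** Each [f i] maps the [t]-neighbourhood of [A] into its [q * t]-neighbourhood, so by invariance
    shrinking the radius loses no mass. Large neighbourhoods exhaust the space, so every
    neighbourhood has measure 1; the small ones decrease to the closed set [A]. *)
Lemma measure_attractor : mu A = 1%E.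
Proof.
have [q /andP[q0 q1] cq] := exists_common_ratio c_lt1.
have step t : 0 < t -> (mu (nbd t) <= mu (nbd (q * t)))%E.
  move=> t0; rewrite [leRHS]mu_inv//.
  have {1}-> : mu (nbd t) = (\sum_i (p i)%:E * mu (nbd t))%E.
    by rewrite -ge0_sume_distrl ?sumEFin ?p_sum ?mul1e// => i _; rewrite lee_fin ltW.
  apply: lee_sum => i _; rewrite lee_pmul2l ?lte_fin//.
  apply: le_measure; rewrite ?inE//.
    rewrite -[X in measurable X]setTI; apply: (ifs_measurable c_gt0 f_lip) => //.
  move=> x [a Aa xa]; exists (f i a); first by apply: (A_sub (i:=i)); exists a.
  apply: le_lt_trans (f_lip _ _ _) _; apply: le_lt_trans (_ : q * enorm (x - a) < _).
    by rewrite ler_wpM2r ?enorm_ge0.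
  by rewrite ltr_pM2l.
have mono s t : 0 < s -> 0 < t -> (mu (nbd t) <= mu (nbd s))%E.
  move=> s0 t0; have [|n qn] := @exists_expr_lt _ _ (s / t) (ltW q0) q1.
    exact: divr_gt0.
  have : (mu (nbd t) <= mu (nbd (q ^+ n * t)))%E.
    elim: n {qn} => [|n IH]; first by rewrite expr0 mul1r.
    apply: le_trans IH _; rewrite exprS -mulrA; apply: step.
    by rewrite mulr_gt0 ?exprn_gt0.
  move=> /le_trans; apply; apply: le_measure; rewrite ?inE//.
  move=> x [a Aa xa]; exists a => //; apply: lt_trans xa _.
  by rewrite -ltr_pdivlMr.
have nbd1 s : 0 < s -> mu (nbd s) = 1%E.
  move=> s0; apply/eqP; rewrite eq_le probability_le1//=.
  have cup : \bigcup_n nbd n.+1%:R = setT.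
    apply/seteqP; split => // x _; have [a Aa] := A_neq0.
    exists (Num.truncn (enorm (x - a))) => //; exists a => //.
    exact: truncnS_gt.
  have cvg1 : mu (nbd n.+1%:R) @[n --> \oo] --> 1%E.
    rewrite -(probability_setT mu) -[X in mu X]cup.
    apply: (@nondecreasing_cvg_mu _ _ _ mu (fun n => nbd n.+1%:R)) => //.
      exact: bigcupT_measurable.
    move=> m n mn; apply/subsetPset => x [a Aa xa]; exists a => //.
    by apply: lt_le_trans xa _; rewrite ler_nat.
  rewrite -(cvg_lim _ cvg1)//; apply: lime_le; first by apply/cvg_ex; exists 1%E.
  by apply: nearW => n; exact: mono.
have cap : \bigcap_n nbd n.+1%:R^-1 = A.
  apply/seteqP; split => [x xcap|a Aa n _]; last first.
    by exists a => //; rewrite subrr enorm0 invr_gt0.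
  apply: A_closed => V /enorm_ball_nbhs[e e0 xV].
  have [a Aa xa] := xcap (Num.truncn e^-1) I; exists a; split => //; apply: xV.
  rewrite enormBC; apply: lt_le_trans xa _.
  by rewrite invf_ple ?posrE// ltW// truncnS_gt.
have cvgA : mu (nbd n.+1%:R^-1) @[n --> \oo] --> mu A.
  rewrite -[X in mu X]cap.
  apply: (@nonincreasing_cvg_mu _ _ _ mu (fun n => nbd n.+1%:R^-1)) => //.
  - exact: le_lt_trans (probability_le1 mu (mnbd _)) (ltry _).
  - exact: bigcapT_measurable.
  - move=> m n mn; apply/subsetPset => x [a Aa xa]; exists a => //.
    by apply: lt_le_trans xa _; rewrite lef_pV2 ?posrE// ler_nat.
rewrite -(cvg_lim _ cvgA)//; apply: cvg_lim => //.
by apply: cvg_near_cst; apply: nearW => n; rewrite nbd1.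
Qed.

End Support.

(** * Upper bound *)

Section UpperBound.
Context {R : realType} {d N : nat} (f : 'I_N -> 'rV[R]_d -> 'rV[R]_d).
Context (p c : 'I_N -> R) (mu : probability (Rd R d) R) (A : set 'rV[R]_d).
Hypothesis p_gt0 : forall i, 0 < p i.
Hypothesis c_gt0 : forall i, 0 < c i.
Hypothesis f_lip : forall i x y, enorm (f i x - f i y) <= c i * enorm (x - y).
Hypothesis mu_inv : is_invariant_measure f p mu.

Lemma distB_image_le i (x : 'rV[R]_d) (B B' : seq 'rV[R]_d) : (0 < size B)%N ->
  {subset map (f i) B <= B'} -> distB (f i x) B' <= c i * distB x B.
Proof.
move=> B0 BB'; rewrite -ler_pdivrMl//; apply/distB_geP => // b bB.
rewrite ler_pdivrMl//; apply: le_trans (f_lip _ _ _).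
by apply: distB_le; apply: BB'; exact: map_f.
Qed.

Lemma moment_finite (r : R) : 0 < r -> A !=set0 -> compact A -> mu A = 1%E ->
  exists a, exists2 M : R, 0 < M & (\int[mu]_x (enorm (x - a) `^ r)%:E <= M%:E)%E.
Proof.
move=> r0 [a Aa] cA muA; exists a.
have mA := compact_measurable_Rd cA.
have [||b _ bmax] := @EVT_max_rV R d (fun x => enorm (x - a)) A _ cA.
- by exists a.
- by apply: continuous_subspaceT; exact: continuous_enormB.
have muAC : mu (~` A) = 0%E by rewrite probability_setC// muA subee.
(* The summand 1 keeps the bound positive when [A] is a single point. *)
exists (enorm (b - a) `^ r + 1); first by rewrite ltr_wpDl ?powR_ge0.
have mh : measurable_fun setT (fun x : Rd R d => (enorm (x - a) `^ r)%:E).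
  apply/measurable_EFinP.
  exact: (measurableT_comp (@measurable_powR R r) (measurable_enormB a)).
rewrite (ge0_negligible_integral _ _ mh _ muAC)//; first last.
- by move=> x _; rewrite lee_fin powR_ge0.
- exact: measurableC.
rewrite setTD setCK.
apply: (@le_trans _ _ (\int[mu]_(x in A) cst (enorm (b - a) `^ r + 1)%:E x)%E).
  apply: ge0_le_integral => //.
  - by move=> x _; rewrite lee_fin powR_ge0.
  - exact: measurable_funTS.
  - move=> x Ax; rewrite lee_fin ler_wpDr// powR_homo_le ?enorm_ge0 ?(ltW r0)//.
    by apply: bmax; rewrite inE.
by rewrite integral_cst//= [X in (_ * X)%E](_ : _ = 1%E)// mule1.
Qed.

(** For [x <= 1] the single point [a] works: [x / qm >= 1] and [x]^ (- beta) >= 1[. For]x >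
    1[, take the union of the images under]f i[of solutions at scale]q i *
    x[. Sizes add up because the]q i[sum to 1; in the error, the relation between]p i[,]c i[and]q
    i[turns the]i[-th term into]q i * (M * x [^ (- beta))]. *)
Lemma upper_recursion (r beta qm M : R) (q : 'I_N -> R) (a : 'rV[R]_d) :
  0 < r -> 0 <= beta -> 0 < M -> 0 < qm -> (forall i, qm <= q i) ->
  (forall i, q i < 1) -> \sum_i q i = 1 ->
  (forall i, p i * c i `^ r * q i `^ (- beta) = q i) ->
  (\int[mu]_x (enorm (x - a) `^ r)%:E <= M%:E)%E ->
  forall x, qm <= x -> exists B : seq 'rV[R]_d,
    [/\ (0 < size B)%N, (size B)%:R <= x / qm &
        (\int[mu]_x (distB x B `^ r)%:E <= (M * x `^ (- beta))%:E)%E].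
Proof.
move=> r0 beta0 M0 qm0 qmq q1 qsum qE intM.
have q0 i : 0 < q i := lt_le_trans qm0 (qmq i).
have [th /andP[th0 th1] qth] := exists_common_ratio q1.
apply: (@scale_induction _ _ _ th); first by rewrite ltW.
  move=> x qmx x1; have x0 : 0 < x := lt_le_trans qm0 qmx.
  exists [:: a]; split=> //; first by rewrite ler_pdivlMr// mul1r.
  have -> : (fun y => (distB y [:: a] `^ r)%:E) = (fun y => (enorm (y - a) `^ r)%:E).
    by apply/funext => y; rewrite /distB big_cons big_nil minxx.
  apply: le_trans intM _; rewrite lee_fin ler_peMr ?(ltW M0)//.
  rewrite powRN invf_ge1 ?powR_gt0//.
  rewrite -[leRHS](_ : 1 `^ beta = 1); last by rewrite powR1.
  by rewrite powR_homo_le ?(ltW x0).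
move=> x qmx x1 IH; have x0 : 0 < x := lt_le_trans qm0 qmx.
have /choice[B BP] i : exists B : seq 'rV[R]_d,
    [/\ (0 < size B)%N, (size B)%:R <= q i * x / qm &
        (\int[mu]_x (distB x B `^ r)%:E <= (M * (q i * x) `^ (- beta))%:E)%E].
  apply: IH; last by rewrite ler_wpM2r ?qth ?ltW.
  by apply: le_trans (qmq i) _; rewrite ler_peMr ?ltW.
pose B' := flatten [seq map (f i) (B i) | i <- index_enum 'I_N].
have subB i : {subset map (f i) (B i) <= B'}.
  move=> y yB; apply/flattenP; exists (map (f i) (B i)) => //.
  by apply: map_f; rewrite mem_index_enum.
have [|i0 _] := @sum_neq0_index _ _ q; first by rewrite qsum oner_neq0.
have B'0 : (0 < size B')%N.
  have [Bi0 _ _] := BP i0; case EB: (B i0) Bi0 => [//|b s] _.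
  have := subB i0 (f i0 b); rewrite EB mem_head => /(_ isT).
  by rewrite lt0n size_eq0; case: eqP => // ->.
exists B'; split=> //.
  rewrite size_flatten sumnE !big_map natr_sum.
  have -> : x / qm = \sum_i q i * x / qm by rewrite -!mulr_suml qsum mul1r.
  apply: ler_sum => i _.
  by rewrite size_map; have [] := BP i.
rewrite (integral_invariant p_gt0 c_gt0 f_lip mu_inv); last 2 first.
- exact: measurable_distB_powR.
- by move=> y; rewrite lee_fin powR_ge0.
have -> : M * x `^ (- beta) = \sum_i p i * (c i `^ r * (M * (q i * x) `^ (- beta))).
  rewrite -[LHS]mul1r -qsum mulr_suml; apply: eq_bigr => i _.
  rewrite -[in LHS]qE powRM ?ltW//; ring.
rewrite -sumEFin; apply: lee_sum => i _; rewrite EFinM lee_pmul2l ?lte_fin//.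
have [Bi0 _ Bint] := BP i.
rewrite EFinM; apply: le_trans (_ : (_ * _ <= _)%E); last first.
  by apply: lee_wpmul2l Bint; rewrite lee_fin powR_ge0.
rewrite -ge0_integralZl_EFin ?powR_ge0//; last 2 first.
- by move=> y _; rewrite lee_fin powR_ge0.
- exact: measurable_distB_powR.
apply: ge0_le_integral => //.
- by move=> y _; rewrite lee_fin powR_ge0.
- apply: (measurableT_comp (measurable_distB_powR B' r)).
  exact: (ifs_measurable c_gt0 f_lip).
- by apply: measurable_funeM; exact: measurable_distB_powR.
- move=> y _; rewrite -EFinM lee_fin -powRM ?distB_ge0 ?(ltW (c_gt0 i))//.
  by rewrite powR_homo_le ?distB_ge0 ?(ltW r0)//; exact: distB_image_le.
Qed.

Lemma Vnr_upper_bound (r l : R) : (forall i, p i < 1) -> (forall i, c i < 1) ->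
  0 < r -> 0 < l ->
  A !=set0 -> compact A -> mu A = 1%E ->
  \sum_i (p i * c i `^ r) `^ (l / (r + l)) = 1 ->
  exists2 C : R, 0 < C &
    forall n, (0 < n)%N -> (Vnr mu n r <= (C * n%:R `^ (- (r / l)))%:E)%E.
Proof.
move=> p1 c1 r0 l0 A0 cA muA qsum.
have [a [M M0 intM]] := moment_finite r0 A0 cA muA.
pose q i := (p i * c i `^ r) `^ (l / (r + l)).
have w0 i : 0 < p i * c i `^ r by rewrite mulr_gt0 ?powR_gt0.
have q0 i : 0 < q i by rewrite powR_gt0.
have t0 : 0 < l / (r + l) by rewrite divr_gt0 ?addr_gt0.
have q1 i : q i < 1.
  apply: powR_lt1 => //; first exact: ltW.
  by rewrite mulr_ilt1 ?powR_ge0 ?ltW//; apply: powR_lt1; rewrite ?ltW.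
have [qm /andP[qm0 _] qmq] := exists_common_lower_bound q0.
have qE i : p i * c i `^ r * q i `^ (- (r / l)) = q i.
  rewrite /q -powRrM -[X in X * _](@powRr1 _ (p i * c i `^ r)) ?(ltW (w0 i))//.
  rewrite -powRD; last by rewrite (gt_eqF (w0 i)) implybT.
  by congr (_ `^ _); field; rewrite !gt_eqF ?addr_gt0.
have rec := upper_recursion r0 (ltW (divr_gt0 r0 l0)) M0 qm0 qmq q1 qsum qE intM.
exists (M * qm `^ (- (r / l))); first by rewrite mulr_gt0 ?powR_gt0.
(* At this scale the size bound [x / qm] is exactly [n]. *)
move=> n n0; have [|B [B0 Bn Bint]] := rec (qm * n%:R).
  by rewrite ler_peMr ?ler1n ?ltW.
rewrite -mulrA -powRM ?(ltW qm0) ?ler0n//; apply: le_trans Bint.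
apply: ereal_inf_lbound; exists B => //=; rewrite B0/=.
by move: Bn; rewrite mulrAC mulfV ?gt_eqF// mul1r ler_nat.
Qed.

End UpperBound.

(** * Lower bound *)

(** A finite type of indices lets the cells of a composite packing be indexed by a sigma type, whose
    cardinality is the sum of those of the pieces. *)
Record packing (R : realType) (d : nat) := Packing {
  cell_index : finType;
  cell : cell_index -> set 'rV[R]_d;
  cell_radius : cell_index -> R }.

Section Packing.
Context {R : realType} {d : nat} (mu : probability (Rd R d) R).
Context (A : set 'rV[R]_d) (delta r : R).

(* Any point is within half a radius of at most one cell, and placing no point
   near a cell costs at least [v / 2 ^ r] in the quantization error. *)
Record is_packing (v : R) (K : packing R d) : Prop := IsPacking {
  cell_compact : forall i, compact (cell (p := K) i);
  cell_sub : forall i, cell (p := K) i `<=` A;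
  cell_radius_gt0 : forall i, 0 < cell_radius (p := K) i;
  cell_radius_le : forall i, cell_radius (p := K) i <= delta;
  cell_separated : forall i j x y, i != j ->
    cell (p := K) i x -> cell (p := K) j y -> cell_radius (p := K) i <= enorm (x - y);
  cell_weight : forall i,
    (v%:E <= mu (cell (p := K) i) * (cell_radius (p := K) i `^ r)%:E)%E }.

Lemma packing_trivIset v (K : packing R d) (D : set (cell_index K)) :
  is_packing v K -> trivIset D (@cell R d K).
Proof.
move=> HK; apply/trivIsetP => i j _ _ ij; apply/seteqP; split => // x [Cix Cjx].
have := cell_separated HK ij Cix Cjx.
by rewrite subrr enorm0 leNgt (cell_radius_gt0 HK).
Qed.

(** Pigeonhole: call a cell bad if some point of [B] is within half its radius. There are at most
    [size B] bad cells, hence at least [m] good ones; these are disjoint, and on each of them the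
    distance to [B] is at least half the radius. *)
Lemma packing_integral_ge v (K : packing R d) (B : seq 'rV[R]_d) (m : nat) :
  is_packing v K -> 0 < r -> 0 <= v -> (0 < size B)%N ->
  (size B + m <= #|cell_index K|)%N ->
  ((m%:R * (v * 2^-1 `^ r))%:E <= \int[mu]_x (distB x B `^ r)%:E)%E.
Proof.
move=> HK r0 v0 B0 Bm.
pose near_cell (i : cell_index K) b :=
  b \in B /\ exists2 x, cell i x & enorm (x - b) < cell_radius i / 2.
pose bad := [set i | `[< exists b, near_cell i b >]]%SET.
have /choice[h hP] i : exists b, i \in bad -> near_cell i b.
  have [[b ib]|nb] := pselect (exists b, near_cell i b); first by exists b.
  by exists 0; rewrite inE => /asboolP.
have cardbad : (#|bad| <= size B)%N.
  rewrite cardE -(size_map h); apply: uniq_leq_size; last first.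
    by move=> b /mapP[i]; rewrite mem_enum => /hP[ib _] ->.
  rewrite map_inj_in_uniq ?enum_uniq// => i j; rewrite !mem_enum.
  move=> /hP[_ [x Cx xi]] /hP[_ [y Cy yj]] hij; apply/eqP/negPn/negP => ij.
  (* The radii may differ, so separation is used in both orders: a distance below half the sum of
     two radii is below one of them. *)
  have sij := cell_separated HK ij Cx Cy.
  have := cell_separated HK (_ : j != i) Cy Cx; rewrite eq_sym enormBC => /(_ ij) sji.
  have := enorm_triangleB x (h i) y; rewrite (enormBC (h i)) => xy.
  by move: yj; rewrite -hij => yj; lra.
have cardgood : (m <= #|~: bad|)%N.
  by rewrite -(leq_add2l (size B)); apply: leq_trans Bm _; rewrite -(cardsC bad) leq_add2r.
have mC i : measurable (cell (p := K) i : set (Rd R d)).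
  by apply: compact_measurable_Rd; exact: (cell_compact HK).
pose good := enum (~: bad).
have mh := measurable_distB_powR B r.
apply: (@le_trans _ _ (\int[mu]_(x in \big[setU/set0]_(i <- good) cell (p := K) i)
    (distB x B `^ r)%:E)%E); last first.
  apply: ge0_subset_integral => //.
  - by apply: bigsetU_measurable => i _; exact: mC.
  - by move=> x _; rewrite lee_fin powR_ge0.
rewrite ge0_integral_bigsetU ?enum_uniq//; first last.
- by move=> x _; rewrite lee_fin powR_ge0.
- exact: measurable_funTS.
- exact: packing_trivIset HK.
rewrite /good big_enum/=.
apply: (@le_trans _ _ (\sum_(i in ~: bad) (v * 2^-1 `^ r)%:E)%E).
  rewrite sumEFin lee_fin sumr_const -[leRHS]mulr_natl ler_wpM2r ?ler_nat//.
  by rewrite mulr_ge0 ?powR_ge0.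
apply: lee_sum => i; rewrite !inE => /asboolPn/forallNP ibad.
have ri0 : 0 < cell_radius i := cell_radius_gt0 HK i.
rewrite EFinM; apply: (@le_trans _ _ (mu (cell i) * (cell_radius i `^ r)%:E * (2^-1 `^ r)%:E)%E).
  by apply: lee_wpmul2r; [rewrite lee_fin powR_ge0|exact: (cell_weight HK)].
rewrite -muleA -EFinM -powRM ?(ltW ri0)// muleC.
rewrite -integral_cst//; apply: ge0_le_integral => //.
- by move=> x _; rewrite lee_fin powR_ge0.
- exact: measurable_funTS.
move=> x Cx; rewrite lee_fin; apply: powR_homo_le; first exact: ltW.
  by rewrite mulr_ge0 ?(ltW ri0).
apply/distB_geP => // b bB; rewrite leNgt; apply/negP => xb.
by apply: (ibad b); split=> //; exists x.
Qed.

(** * Packings built by self-similar recursion *)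

Section SelfSimilar.
Context (J : finType) (g : J -> 'rV[R]_d -> 'rV[R]_d) (P S Q : J -> R).
Context (gamma qm : R).
Hypothesis g_cont : forall j, continuous (g j).
Hypothesis g_sub : forall j, g j @` A `<=` A.
Hypothesis g_separated : forall i j x y, i != j -> A x -> A y ->
  delta <= enorm (g i x - g j y).
Hypothesis S_gt0 : forall j, 0 < S j.
Hypothesis S_le1 : forall j, S j <= 1.
Hypothesis g_expand : forall j x y, S j * enorm (x - y) <= enorm (g j x - g j y).
Hypothesis P_ge0 : forall j, 0 <= P j.
Hypothesis g_mass : forall j (C : set 'rV[R]_d), compact C ->
  ((P j)%:E * mu C <= mu (g j @` C))%E.
Hypothesis qm_gt0 : 0 < qm.
Hypothesis Q_ge : forall j, qm <= Q j.
Hypothesis Q_lt1 : forall j, Q j < 1.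
Hypothesis Q_sum : 1 <= \sum_j Q j.
Hypothesis QE : forall j, P j * S j `^ r = Q j `^ gamma.
Hypothesis delta_gt0 : 0 < delta.
Hypothesis gamma_gt0 : 0 < gamma.
Hypothesis A_compact : compact A.
Hypothesis A_mass : mu A = 1%E.

(** Normalised so that the single cell [A] of radius [delta] has this weight at every scale from
    [qm] on. Passing from scale [Q j * x] to [x] multiplies it by [Q j]^ gamma[, which is]P j * S j
    [^ r]. *)
Let weight (x : R) := delta `^ r * (qm / x) `^ gamma.

Definition image_packing (K : J -> packing R d) : packing R d :=
  @Packing R d {j : J & cell_index (K j)}
    (fun i => g (tag i) @` cell (tagged i))
    (fun i => S (tag i) * cell_radius (tagged i)).

Lemma image_packingP x (K : J -> packing R d) : 0 < x ->
  (forall j, is_packing (weight (Q j * x)) (K j)) ->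
  is_packing (weight x) (image_packing K).
Proof.
move=> x0 HK; split=> /=.
- move=> [j i] /=; apply: continuous_compact; last exact: (cell_compact (HK j)).
  by apply: continuous_subspaceT; exact: g_cont.
- move=> [j i] /= _ [y Cy <-]; apply: (g_sub (j := j)); exists y => //.
  exact: (cell_sub (HK j)) Cy.
- by move=> [j i] /=; rewrite mulr_gt0// (cell_radius_gt0 (HK j)).
- move=> [j i] /=; apply: le_trans (cell_radius_le (HK j) i).
  by rewrite ler_piMl// ltW// (cell_radius_gt0 (HK j)).
- move=> [j i] [j' i'] /= _ _ ii' [y Cy <-] [z Cz <-].
  have [ejj'|jj'] := eqVneq j j'; last first.
    apply: le_trans (g_separated jj' (cell_sub (HK j) Cy) (cell_sub (HK j') Cz)).
    apply: le_trans (cell_radius_le (HK j) i).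
    by rewrite ler_piMl// ltW// (cell_radius_gt0 (HK j)).
  subst j'; apply: le_trans (g_expand _ _ _); rewrite ler_pM2l//.
  apply: (cell_separated (HK j)) Cy Cz.
  by apply: contra_neq ii' => ->.
- move=> [j i] /=; have Q0 : 0 < Q j := lt_le_trans qm_gt0 (Q_ge j).
  have -> : weight x = weight (Q j * x) * Q j `^ gamma.
    rewrite /weight -mulrA -powRM ?(ltW Q0)//; last first.
      by rewrite divr_ge0 ?mulr_ge0 ?(ltW Q0) ?(ltW qm_gt0) ?(ltW x0).
    by congr (_ * _ `^ _); field; rewrite !gt_eqF.
  rewrite -QE powRM ?(ltW (S_gt0 j)) ?(ltW (cell_radius_gt0 (HK j) i))// !EFinM.
  have finC : mu (cell i) \is a fin_num.
    by apply: fin_num_measure; apply: compact_measurable_Rd; exact: (cell_compact (HK j)).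
  have := cell_weight (HK j) i; rewrite -(fineK finC) -EFinM lee_fin => w.
  apply: (@le_trans _ _ ((P j)%:E * mu (cell i) * (S j `^ r * cell_radius i `^ r)%:E)%E).
    rewrite -(fineK finC) -!EFinM lee_fin.
    apply: le_trans (ler_wpM2r _ w) _; first by rewrite mulr_ge0 ?powR_ge0.
    by rewrite le_eqVlt; apply/orP; left; apply/eqP; ring.
  rewrite lee_wpmul2r ?lee_fin ?mulr_ge0 ?powR_ge0//.
  by apply: g_mass; exact: (cell_compact (HK j)).
Qed.

(** For [x <= 1] one cell, [A] itself, is enough. For larger [x] the images of the packings at
    scales [Q j * x] number at least [\sum_j Q j * x], which is at least [x]. *)
Lemma packing_exists x : qm <= x ->
  exists2 K, is_packing (weight x) K & x <= #|cell_index K|%:R.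
Proof.
have [th /andP[th0 th1] Qth] := exists_common_ratio Q_lt1.
move: x; apply: (@scale_induction _ _ _ th); first by rewrite ltW.
  move=> x qmx x1; have x0 : 0 < x := lt_le_trans qm_gt0 qmx.
  exists (@Packing R d unit (fun=> A) (fun=> delta)); last by rewrite card_unit.
  split=> //= [[] [] //|_].
  rewrite A_mass mul1e lee_fin /weight ler_piMr ?powR_ge0//.
  rewrite -[leRHS](_ : 1 `^ gamma = 1); last by rewrite powR1.
  by rewrite powR_homo_le ?(ltW gamma_gt0) ?divr_ge0 ?(ltW x0) ?(ltW qm_gt0)// ler_pdivrMr// mul1r.
move=> x qmx x1 IH; have x0 : 0 < x := lt_le_trans qm_gt0 qmx.
have /choice[K HK] j : exists K, is_packing (weight (Q j * x)) K /\
    Q j * x <= #|cell_index K|%:R.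
  have [||K] := IH (Q j * x); last by exists K.
  - by apply: le_trans (Q_ge j) _; rewrite ler_peMr ?ltW// (lt_le_trans qm_gt0).
  - by rewrite ler_wpM2r ?Qth ?ltW.
exists (image_packing K); first by apply: image_packingP => // j; have [] := HK j.
apply: (@le_trans _ _ (\sum_j Q j * x)).
  by rewrite -mulr_suml ler_peMl ?(ltW x0).
rewrite /= card_tagged sumnE big_map big_enum natr_sum /=.
by apply: ler_sum => j _; have [] := HK j.
Qed.

Lemma Vnr_lower_bound : qm <= 1 -> 0 < r -> exists2 C : R, 0 < C &
  forall n, (0 < n)%N -> ((C * n%:R `^ (1 - gamma))%:E <= Vnr mu n r)%E.
Proof.
move=> qm1 r0; exists (delta `^ r * (qm / 2) `^ gamma * 2^-1 `^ r).
  by rewrite !mulr_gt0 ?powR_gt0 ?divr_gt0 ?invr_gt0.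
move=> n n0; have n0R : 0 < n%:R :> R by rewrite ltr0n.
have [|K HK Kcard] := @packing_exists (n + n)%:R.
  by apply: le_trans qm1 _; rewrite ler1n addn_gt0 n0.
apply: le_ereal_inf_tmp => _ [B /= /andP[B0 Bn] <-].
apply: le_trans (packing_integral_ge HK r0 _ B0 (_ : size B + n <= _)%N); last 2 first.
- by rewrite mulr_ge0 ?powR_ge0.
- by rewrite -(ler_nat R); apply: le_trans Kcard; rewrite ler_nat leq_add2r.
rewrite lee_fin le_eqVlt; apply/orP; left; apply/eqP.
rewrite /weight; have -> : qm / (n + n)%:R = qm / 2 * n%:R^-1.
  by rewrite -mulrA -invfM natrD -mulr2n -[_ *+ 2]mulr_natl.
rewrite powRD; last by rewrite (gt_eqF n0R) implybT.
rewrite powRr1 ?(ltW n0R)// powRN.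
rewrite [in RHS]powRM ?invr_ge0 ?(ltW n0R) ?divr_ge0 ?(ltW qm_gt0)//.
suff -> : n%:R^-1 `^ gamma = (n%:R `^ gamma)^-1 by ring.
by rewrite -powR_inv1 ?(ltW n0R)// -powRrM mulN1r powRN.
Qed.

End SelfSimilar.

End Packing.

(** The distance attains its minimum on the compact product, and a zero minimum would give a common
    point. If the product is empty, any [e] serves. *)
Lemma compact_separated (R : realType) (d : nat) (C D : set 'rV[R]_d) :
  compact C -> compact D -> C `&` D = set0 ->
  exists2 e : R, 0 < e & forall x y, C x -> D y -> e <= enorm (x - y).
Proof.
move=> cC cD CD0.
have [[z [Cz Dz]]|CDX0] := pselect (exists z, (C `*` D) z); last first.
  by exists 1 => // x y Cx Dy; exfalso; apply: CDX0; exists (x, y).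
have cont : continuous (fun z : 'rV[R]_d * 'rV[R]_d => enorm (z.1 - z.2)).
  move=> u; apply: continuous_comp; last exact: continuous_enorm.
  by apply: continuousB; [exact: cvg_fst|exact: cvg_snd].
have [|[x y]] := compact_EVT_min _ (compact_setX cC cD) (continuous_subspaceT cont).
  by exists z.
rewrite inE => -[/= Cx Dy] xy.
exists (enorm (x - y)) => [|x' y' Cx' Dy']; last first.
  by apply: (xy (x', y')); rewrite inE.
rewrite lt_neqAle enorm_ge0 andbT eq_sym; apply/eqP => xy0.
have : (C `&` D) x; last by rewrite CD0.
split=> //; suff -> : x = y by [].
by apply/eqP; rewrite -subr_eq0 -normr_le0 -xy0 norm_le_enorm.
Qed.

(** * Compositions of the maps along words *)

Section Words.
Context {R : realType} {d N : nat} (f : 'I_N -> 'rV[R]_d -> 'rV[R]_d).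
Implicit Types (w : seq 'I_N).

Definition word_map w : 'rV[R]_d -> 'rV[R]_d := foldr (fun i g => f i \o g) id w.

Lemma word_map_cat w1 w2 x : word_map (w1 ++ w2) x = word_map w1 (word_map w2 x).
Proof. by elim: w1 => //= i w1 IH; rewrite IH. Qed.

Lemma word_map_continuous w : (forall i, continuous (f i)) -> continuous (word_map w).
Proof.
move=> cf; elim: w => [|i w IH] x; first exact: (fun U => id).
exact: (continuous_comp (IH x) (cf i _)).
Qed.

Lemma word_map_sub w (V : set 'rV[R]_d) :
  (forall i, f i @` V `<=` V) -> word_map w @` V `<=` V.
Proof.
move=> fV _ [x Vx <-]; elim: w => //= i w IH.
by apply: (fV i); exists (word_map w x).
Qed.

Lemma word_map_expand w (s : 'I_N -> R) x y : (forall i, 0 < s i) ->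
  (forall i x y, s i * enorm (x - y) <= enorm (f i x - f i y)) ->
  (\prod_(i <- w) s i) * enorm (x - y) <= enorm (word_map w x - word_map w y).
Proof.
move=> s0 fs; elim: w => [|i w IH]; first by rewrite big_nil mul1r.
rewrite big_cons -mulrA; apply: le_trans (fs _ _ _).
by rewrite ler_pM2l.
Qed.

Lemma word_map_contract w (q : R) x y : 0 <= q ->
  (forall i x y, enorm (f i x - f i y) <= q * enorm (x - y)) ->
  enorm (word_map w x - word_map w y) <= q ^+ size w * enorm (x - y).
Proof.
move=> q0 fq; elim: w => [|i w IH]; first by rewrite mul1r.
apply: le_trans (fq _ _ _) _.
by rewrite exprS -mulrA ler_wpM2l.
Qed.

Lemma word_map_mass w (p : 'I_N -> R) (mu : probability (Rd R d) R)
    (C : set 'rV[R]_d) : (forall i, continuous (f i)) ->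
  (forall i, 0 < p i) ->
  (forall i (C : set 'rV[R]_d), compact C -> ((p i)%:E * mu C <= mu (f i @` C))%E) ->
  compact C -> ((\prod_(i <- w) p i)%:E * mu C <= mu (word_map w @` C))%E.
Proof.
move=> cf p0 fp cC; elim: w => [|i w IH].
  by rewrite big_nil mul1e image_id.
rewrite big_cons EFinM -muleA.
rewrite (_ : word_map (i :: w) @` C = f i @` (word_map w @` C)); last by rewrite image_comp.
apply: le_trans (fp _ _ _); last first.
  by apply: continuous_compact cC; apply: continuous_subspaceT; exact: word_map_continuous.
by rewrite lee_pmul2l ?lte_fin.
Qed.

(** If the first letters differ, the images lie in two disjoint sets [f i @] U[and]f j @[U]; if they
    agree, injectivity removes the letter. Equal lengths prevent one word from being a prefix of the
    other. *)
Lemma word_map_disjoint (U : set 'rV[R]_d) w w' :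
  (forall i, injective (f i)) -> (forall i, f i @` U `<=` U) ->
  (forall i j, i != j -> f i @` U `&` f j @` U = set0) ->
  size w = size w' -> w != w' ->
  word_map w @` U `&` word_map w' @` U = set0.
Proof.
move=> f_inj fU f_disj; elim: w w' => [|i w IH] [|j w']//= [sz] neq.
apply/seteqP; split=> // _ [[x Ux <-] [y Uy /= yx]].
have Uw v z : U z -> U (word_map v z) by move=> Uz; apply: (@word_map_sub v U fU); exists z.
have [ij|ij] := eqVneq i j; last first.
  suff : (f i @` U `&` f j @` U) (f i (word_map w x)) by rewrite f_disj.
  by split; [exists (word_map w x)|exists (word_map w' y)] => //; exact: Uw.
subst j; have ww' : w != w' by apply: contra_neq neq => ->.
have := IH _ sz ww'; move/seteqP => [+ _] => /(_ (word_map w x)); apply.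
by split; [exists x|exists y => //; exact: f_inj yx].
Qed.

Lemma attractor_word (A : set 'rV[R]_d) a n : A = \bigcup_(i in setT) (f i @` A) ->
  A a -> exists w, size w = n /\ (word_map w @` A) a.
Proof.
move=> AE; elim: n a => [|n IH] a Aa; first by exists [::]; split=> //; exists a.
move: (Aa); rewrite {1}AE => -[i _ [b Ab ba]].
have [w [sz [x Ax xb]]] := IH b Ab.
by exists (i :: w); rewrite /= sz; split=> //; exists x => //=; rewrite xb.
Qed.

(** Follow a point [a] of [A] in [U] through [n] levels of the attractor: the resulting image of [A]
    contains [a] and has diameter at most [q ^+ n * M], which for large [n] is below the radius of a
    ball around [a] inside [U]. *)
Lemma attractor_word_sub (A U : set 'rV[R]_d) (q : R) : 0 <= q < 1 ->
  (forall i x y, enorm (f i x - f i y) <= q * enorm (x - y)) ->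
  A = \bigcup_(i in setT) (f i @` A) -> compact A -> open U -> U `&` A !=set0 ->
  exists w, word_map w @` A `<=` U.
Proof.
move=> /andP[q0 q1] fq AE cA oU [a [Ua Aa]].
have [e e0 eU] := enorm_ball_nbhs (open_nbhs_nbhs (conj oU Ua)).
have [M M0 AM] : exists2 M, 0 < M & forall x y, A x -> A y -> enorm (x - y) < M.
  have [||b _ bmax] := @EVT_max_rV R d (fun x => enorm (x - a)) A _ cA.
  - by exists a.
  - by apply: continuous_subspaceT; exact: continuous_enormB.
  have b0 := enorm_ge0 (b - a).
  exists (enorm (b - a) + enorm (b - a) + 1) => [|x y Ax Ay]; first by lra.
  have := enorm_triangleB x a y; rewrite (enormBC a y).
  have := bmax x; rewrite inE => /(_ Ax).
  have := bmax y; rewrite inE => /(_ Ay).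
  by lra.
have [|n qn] := @exists_expr_lt _ _ (e / M) q0 q1; first exact: divr_gt0.
have [w [sz [x Ax xa]]] := attractor_word n AE Aa.
exists w => _ [y Ay <-]; apply: eU; rewrite -xa.
apply: le_lt_trans (word_map_contract w y x q0 fq) _; rewrite sz.
apply: le_lt_trans (_ : q ^+ n * M < _).
  by rewrite ler_wpM2l ?exprn_ge0// ltW// AM.
by rewrite -ltr_pdivlMr.
Qed.

End Words.

(** * Lower bound for the IFS under the strong open set condition *)

Section LowerBound.
Context {R : realType} {d N : nat} (f : 'I_N -> 'rV[R]_d -> 'rV[R]_d).
Context (p s c : 'I_N -> R) (mu : probability (Rd R d) R) (A : set 'rV[R]_d).
Hypothesis p_gt0 : forall i, 0 < p i.
Hypothesis p_sum : \sum_i p i = 1.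
Hypothesis p_lt1 : forall i, p i < 1.
Hypothesis s_gt0 : forall i, 0 < s i.
Hypothesis s_le_c : forall i, s i <= c i.
Hypothesis c_lt1 : forall i, c i < 1.
Hypothesis f_expand : forall i x y, s i * enorm (x - y) <= enorm (f i x - f i y).
Hypothesis f_lip : forall i x y, enorm (f i x - f i y) <= c i * enorm (x - y).
Hypothesis mu_inv : is_invariant_measure f p mu.
Hypothesis A_attractor : is_attractor f A.
Hypothesis A_mass : mu A = 1%E.
Hypothesis f_sosc : SOSC f A.

Let c_gt0 i : 0 < c i. Proof. exact: lt_le_trans (s_le_c i). Qed.

Lemma ifs_injective i : injective (f i).
Proof.
move=> x y fxy; have := f_expand i x y.
rewrite fxy subrr enorm0 pmulr_rle0// => xy0.
by apply/eqP; rewrite -subr_eq0 -normr_le0; apply: le_trans xy0; exact: norm_le_enorm.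
Qed.

Lemma ifs_Vnr_lower_bound (r k k' : R) : 0 < r -> 0 < k' -> k' < k ->
  \sum_i (p i * s i `^ r) `^ (k / (r + k)) = 1 ->
  exists2 C : R, 0 < C &
    forall n, (0 < n)%N -> ((C * n%:R `^ (- (r / k')))%:E <= Vnr mu n r)%E.
Proof.
move=> r0 k'0 k'k sum1; have k0 : 0 < k := lt_trans k'0 k'k.
have [A0 [cA AE]] := A_attractor.
have [U [oU U0 fU f_disj UA]] := f_sosc.
have fA i : f i @` A `<=` A by move=> y Ay; rewrite AE; exists i.
have cf i : continuous (f i) by apply: ifs_continuous; [exact: c_gt0|exact: f_lip].
have [q /andP[q0 q1] cq] := exists_common_ratio c_lt1.
have [tau tauU] : exists w, word_map f w @` A `<=` U.
  apply: (attractor_word_sub (q := q)) => //; first by rewrite (ltW q0).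
  move=> i x y; apply: le_trans (f_lip i x y) _.
  by rewrite ler_wpM2r ?enorm_ge0.
pose t := k' / (r + k').
have t0 : 0 < t by rewrite divr_gt0 ?addr_gt0.
pose b i := p i * s i `^ r.
have b0 i : 0 < b i by rewrite mulr_gt0 ?powR_gt0.
have s1 i : s i < 1 := le_lt_trans (s_le_c i) (c_lt1 i).
have b1 i : b i < 1.
  by rewrite mulr_ilt1 ?powR_ge0 ?(ltW (p_gt0 i))//; apply: powR_lt1; rewrite ?(ltW (s_gt0 i)).
(* The exponent [k / (r + k)] increases with [k], so [t] is the smaller one, and [b i < 1] makes
   every term strictly larger than the corresponding term of the sum for [k]. *)
have sum_gt1 : 1 < \sum_i b i `^ t.
  rewrite -[X in X < _]sum1; apply: ltr_sum => [|i _].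
    have [|i _] := @sum_neq0_index _ _ p; last first.
      by apply/hasP; exists i; rewrite ?mem_index_enum.
    by rewrite p_sum oner_neq0.
  have -> : k / (r + k) = t + (k / (r + k) - t) by ring.
  rewrite powRD; last by rewrite (gt_eqF (b0 i)) implybT.
  rewrite gtr_pMr; last exact: powR_gt0 (b0 i).
  apply: powR_lt1; [|exact: (ltW (b0 i))|exact: b1].
  rewrite subr_gt0 /t ltr_pdivrMr ?addr_gt0// mulrAC ltr_pdivlMr ?addr_gt0//.
  by rewrite !mulrDr [k' * k]mulrC ltrD2r ltr_pM2r.
pose sigma := \sum_i b i `^ t.
have sigma0 : 0 < sigma := lt_trans ltr01 sum_gt1.
(* Appending [tau] costs a fixed factor in the sum over words; [n] is chosen so that [sigma ^+ n]
   outweighs it. *)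
have [|||n sn] := @exists_expr_lt _ sigma^-1 ((\prod_(i <- tau) b i) `^ t).
- by rewrite invr_ge0 ltW.
- by rewrite invf_lt1.
- by rewrite powR_gt0// prodr_gt0.
(* The extra letter makes every [word w] nonempty even if [n] is 0 and [tau] is empty, as [Q w < 1]
   requires; its factor [sigma > 1] only helps the sum. *)
pose J : finType := n.+1.-tuple 'I_N.
pose word (w : J) := tval w ++ tau.
pose K := word_map f tau @` A.
have cK : compact K.
  by apply: continuous_compact cA; apply: continuous_subspaceT; exact: word_map_continuous.
have KU (w : J) : word_map f w @` K `<=` word_map f w @` U.
  by move=> _ [y Ky <-]; exists y => //; exact: tauU.
(* A separation is chosen for every pair of words, with the placeholder 1 on the diagonal, so that
   the finite minimum [delta] serves all pairs. *)
have /choice[e eP] (ww : J * J) : exists e : R, 0 < e /\ (ww.1 != ww.2 ->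
    forall x y, K x -> K y -> e <= enorm (word_map f ww.1 x - word_map f ww.2 y)).
  case: ww => w w' /=; have [->|ww'] := eqVneq w w'; first by exists 1.
  have cwK (v : J) : compact (word_map f v @` K).
    by apply: continuous_compact cK; apply: continuous_subspaceT; exact: word_map_continuous.
  have [|e e0 eP] := compact_separated (cwK w) (cwK w').
    apply/seteqP; split=> // y [/KU wy /KU w'y].
    by rewrite -(word_map_disjoint ifs_injective fU f_disj _ ww') ?size_tuple.
  by exists e; split=> // _ x y Kx Ky; apply: eP; [exists x|exists y].
have [delta /andP[delta0 _] deltaP] :=
  exists_common_lower_bound (fun ww => (eP ww).1).
pose Q (w : J) := (\prod_(i <- word w) b i) `^ t.
have Q0 w : 0 < Q w by rewrite powR_gt0// prodr_gt0.
have [qm /andP[qm0 qm1] qmQ] := exists_common_lower_bound Q0.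
have P0 (w : seq 'I_N) : 0 < \prod_(i <- w) p i by rewrite prodr_gt0.
have S0 (w : seq 'I_N) : 0 < \prod_(i <- w) s i by rewrite prodr_gt0.
have szw w : (0 < size (word w))%N by rewrite size_cat size_tuple.
have := @Vnr_lower_bound _ _ mu A delta r J (fun w => word_map f (word w))
  (fun w => \prod_(i <- word w) p i) (fun w => \prod_(i <- word w) s i) Q t^-1 qm.
(* Here [gamma] is [t^-1 = (r + k') / k']. *)
have -> : 1 - t^-1 = - (r / k').
  by rewrite /t; field; rewrite !gt_eqF ?addr_gt0.
apply=> //.
- by move=> w; exact: word_map_continuous.
- by move=> w; exact: word_map_sub.
- move=> w w' x y ww' Ax Ay; rewrite /word !word_map_cat.
  apply: le_trans (deltaP (w, w')) _; apply: (eP (w, w')).2 => //=.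
    by exists x.
  by exists y.
- by move=> w; apply/ltW/prod_lt1 => // i; rewrite s_gt0 s1.
- by move=> w x y; exact: word_map_expand.
- by move=> w; exact: ltW.
- move=> w C cC; apply: word_map_mass => // i D cD.
  exact: (invariant_image_ge p_gt0 c_gt0 f_lip mu_inv).
- move=> w; apply: powR_lt1 => //; first by rewrite ltW// prodr_gt0.
  by apply: prod_lt1 => // i; rewrite b0 b1.
(* The sum factors as [sigma ^+ n.+1] times the factor of [tau]. *)
- rewrite /Q; under eq_bigr => w _ do rewrite -prod_powR// big_cat/=.
  rewrite -mulr_suml (@sum_tuple_prod R 'I_N n.+1 (fun i => b i `^ t)) prod_powR//.
  rewrite exprS -/sigma -mulrA; apply: mulr_ege1; first exact: ltW.
  by rewrite mulrC -ler_pdivrMr ?exprn_gt0// div1r -exprVn ltW.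
- move=> w; rewrite /Q -powRrM mulfV ?gt_eqF// powRr1 ?ltW ?prodr_gt0//.
  by rewrite -prod_powR// -big_split.
- by rewrite invr_gt0.
Qed.

End LowerBound.

(** * Quantization dimensions *)

Section Asymptotics.
Context {R : realType} {d : nat} (mu : probability (Rd R d) R) (r : R).
Hypothesis r_gt0 : 0 < r.

Lemma limn_esup_le_eventually (u : (\bar R)^nat) (l : \bar R) n0 :
  (forall n, (n0 <= n)%N -> (u n <= l)%E) -> (limn_esup u <= l)%E.
Proof.
move=> ul; rewrite /limn_esup limf_esupE.
apply: le_trans (ereal_inf_lbound _) _.
  by exists [set n | (n0 <= n)%N] => //; exists n0.
by apply: ge_ereal_sup => _ [n nn0 <-]; exact: ul.
Qed.

Lemma limn_einf_ge_eventually (u : (\bar R)^nat) (l : \bar R) n0 :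
  (forall n, (n0 <= n)%N -> (l <= u n)%E) -> (l <= limn_einf u)%E.
Proof.
move=> ul; rewrite /limn_einf leeNr.
by apply: (limn_esup_le_eventually (n0 := n0)) => n /ul; rewrite leeN2.
Qed.

Lemma ln_natr_ge (T : R) : exists n0, forall n, (n0 <= n)%N -> (0 < n)%N /\ T <= ln n%:R.
Proof.
exists (Num.truncn (expR T)).+1 => n nT; have n0 := leq_ltn_trans (leq0n _) nT.
split=> //; rewrite -ler_expR lnK ?posrE ?ltr0n//.
by apply/ltW/(lt_le_trans (truncnS_gt _)); rewrite ler_nat.
Qed.

(** Positivity of [Vnr] keeps [ln] away from its default value at 0, and the upper bound makes [Vnr]
    finite, so that [fine] is faithful. *)
Lemma neg_ln_enr_ge (C beta : R) n : (0 < n)%N -> 0 < C ->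
  (0 < Vnr mu n r)%E -> (Vnr mu n r <= (C * n%:R `^ (- beta))%:E)%E ->
  (beta * ln n%:R - ln C) / r <= - ln (enr mu n r).
Proof.
move=> n0 C0 V0 VC; have nR : 0 < n%:R :> R by rewrite ltr0n.
have fV : Vnr mu n r \is a fin_num.
  by rewrite fin_numElt (lt_trans _ V0) ?ltNyr//= (le_lt_trans VC) ?ltry.
rewrite -(fineK fV) lte_fin in V0; rewrite -(fineK fV) lee_fin in VC.
rewrite /enr ln_powR mulrC -mulrN ler_pM2l ?invr_gt0// lerNr opprB.
apply: le_trans (_ : ln (C * n%:R `^ (- beta)) <= _).
  by rewrite ler_ln ?posrE ?mulr_gt0 ?powR_gt0.
by rewrite lnM ?posrE ?powR_gt0// ln_powR mulNr.
Qed.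

Lemma neg_ln_enr_le (C beta : R) n : (0 < n)%N -> 0 < C ->
  (Vnr mu n r < +oo)%E -> ((C * n%:R `^ (- beta))%:E <= Vnr mu n r)%E ->
  - ln (enr mu n r) <= (beta * ln n%:R - ln C) / r.
Proof.
move=> n0 C0 V0 VC; have nR : 0 < n%:R :> R by rewrite ltr0n.
have C'0 : 0 < C * n%:R `^ (- beta) by rewrite mulr_gt0 ?powR_gt0.
have fV : Vnr mu n r \is a fin_num.
  by rewrite fin_numElt V0 andbT (lt_le_trans _ VC) ?ltNyr.
rewrite -(fineK fV) lee_fin in VC.
rewrite /enr ln_powR mulrC -mulNr ler_pM2r ?invr_gt0// lerNl opprB.
apply: le_trans (_ : _ <= ln (C * n%:R `^ (- beta))) _.
  by rewrite lnM ?posrE ?powR_gt0// ln_powR mulNr.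
by rewrite ler_ln ?posrE// (lt_le_trans C'0).
Qed.

Lemma quant_dim_upper_le (l : R) : 0 < l ->
  (forall n, (0 < n)%N -> (0 < Vnr mu n r)%E) ->
  (exists2 C : R, 0 < C &
    forall n, (0 < n)%N -> (Vnr mu n r <= (C * n%:R `^ (- (r / l)))%:E)%E) ->
  (quant_dim_upper mu r <= l%:E)%E.
Proof.
move=> l0 V0 [C C0 VC]; apply/lee_addgt0Pr => e e0.
(* Beyond the first threshold the lower bound [L / l - ln C / r] for the denominator is positive;
   beyond the second, [l + e] times that bound is at least [L]. *)
have [n0 n0P] := ln_natr_ge (Num.max (l * ln C / r + 1) ((l + e) * l * ln C / (r * e))).
apply: (limn_esup_le_eventually (n0 := n0)) => n /n0P[n_gt0]; rewrite ge_max => /andP[nT nT'].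
rewrite -EFinD lee_fin.
have D := neg_ln_enr_ge n_gt0 C0 (V0 _ n_gt0) (VC _ n_gt0).
set L := ln n%:R in nT nT' D *; set D' := - ln (enr _ _ _) in D *.
have DE : (r / l * L - ln C) / r = L / l - ln C / r by field; rewrite !gt_eqF.
rewrite DE in D.
have D0 : 0 < D'.
  apply: lt_le_trans D; rewrite subr_gt0 ltr_pdivlMr// mulrC mulrA; lra.
rewrite ler_pdivrMr//; apply: le_trans (ler_wpM2l _ D); last by lra.
rewrite mulrBr -subr_ge0.
have -> : (l + e) * (L / l) - (l + e) * (ln C / r) - L =
    (L - (l + e) * l * ln C / (r * e)) * (e / l) by field; rewrite !gt_eqF.
by rewrite mulr_ge0 ?divr_ge0 ?subr_ge0 ?(ltW e0) ?(ltW l0).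
Qed.

(** The upper bound on [Vnr] makes the denominator [- ln (enr mu n r)] eventually positive, so the
    quotient can be bounded below by multiplying out. *)
Lemma quant_dim_lower_ge (k l : R) : 0 < k -> 0 < l ->
  (forall k', 0 < k' -> k' < k -> exists2 C : R, 0 < C &
    forall n, (0 < n)%N -> ((C * n%:R `^ (- (r / k')))%:E <= Vnr mu n r)%E) ->
  (exists2 C : R, 0 < C &
    forall n, (0 < n)%N -> (Vnr mu n r <= (C * n%:R `^ (- (r / l)))%:E)%E) ->
  (k%:E <= quant_dim_lower mu r)%E.
Proof.
move=> k0 l0 Vk [C C0 VC]; apply/lee_subgt0Pr => e e0.
(* The maximum with [k / 2] keeps [m] positive when [e >= k]. Taking [k'] strictly between [m] and
   [k] leaves a gap [k' - m] that absorbs the constant [B] for large [n]. *)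
pose m := Num.max (k - e) (k / 2).
have mk : m < k by rewrite gt_max; apply/andP; split; lra.
have m0 : 0 < m by rewrite lt_max divr_gt0 ?orbT.
apply: (@le_trans _ _ m%:E); first by rewrite -EFinB lee_fin le_max lexx.
pose k' := (m + k) / 2.
have mk' : m < k' by rewrite /k'; lra.
have k'k : k' < k by rewrite /k'; lra.
have k'0 : 0 < k' := lt_trans m0 mk'.
have [B B0 VB] := Vk _ k'0 k'k.
(* The first threshold makes the denominator positive; the second is where [m] times its upper bound
   [(r / k' * L - ln B) / r] drops to at most [L]. *)
have [n0 n0P] := ln_natr_ge (Num.max (l * ln C / r + 1) (- (m * k' * ln B) / (r * (k' - m)))).
apply: (limn_einf_ge_eventually (n0 := n0)) => n /n0P[n_gt0]; rewrite ge_max => /andP[nT nT'].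
rewrite lee_fin.
have nR : 0 < n%:R :> R by rewrite ltr0n.
have V0 : (0 < Vnr mu n r)%E.
  by apply: lt_le_trans (VB _ n_gt0); rewrite lte_fin mulr_gt0 ?powR_gt0.
have Vy : (Vnr mu n r < +oo)%E := le_lt_trans (VC _ n_gt0) (ltry _).
have D := neg_ln_enr_ge n_gt0 C0 V0 (VC _ n_gt0).
have D2 := neg_ln_enr_le n_gt0 B0 Vy (VB _ n_gt0).
set L := ln n%:R in nT nT' D D2 *; set D' := - ln (enr _ _ _) in D D2 *.
have DE : (r / l * L - ln C) / r = L / l - ln C / r by field; rewrite !gt_eqF.
rewrite DE in D.
have D0 : 0 < D'.
  apply: lt_le_trans D; rewrite subr_gt0 ltr_pdivlMr// mulrC mulrA; lra.
rewrite ler_pdivlMr//; apply: le_trans (ler_wpM2l (ltW m0) D2) _.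
rewrite -subr_ge0.
have k'm : k' - m != 0 by rewrite subr_eq0 gt_eqF.
have -> : L - m * ((r / k' * L - ln B) / r) =
    (L - (- (m * k' * ln B) / (r * (k' - m)))) * ((k' - m) / k').
  by field; rewrite k'm !gt_eqF.
apply: mulr_ge0; first by rewrite subr_ge0.
by rewrite divr_ge0 ?subr_ge0 ?(ltW mk') ?(ltW k'0).
Qed.

End Asymptotics.

Unset Implicit Arguments.
Set Strict Implicit.
Set Printing Implicit Defensive.

Theorem theorem4 (R : realType) (d N : nat) (hN : (2 <= N)%N)
    (f : 'I_N -> 'rV[R]_d -> 'rV[R]_d) (p s c : 'I_N -> R)
    (hp : forall i, 0 < p i) (hpsum : \sum_(i < N) p i = 1)
    (hs : forall i, 0 < s i) (hsc : forall i, s i <= c i) (hc : forall i, c i < 1)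
    (hbilip : forall i x y,
        s i * enorm (x - y) <= enorm (f i x - f i y) /\
        enorm (f i x - f i y) <= c i * enorm (x - y))
    (A : set 'rV[R]_d) (hA : is_attractor f A)
    (mu : probability (Rd R d) R) (hmu : is_invariant_measure f p mu)
    (hsosc : SOSC f A)
    (r : R) (hr : 0 < r) (k l : R) (hk : 0 < k) (hl : 0 < l)
    (hkdef : \sum_(i < N) powR (p i * powR (s i) r) (k / (r + k)) = 1)
    (hldef : \sum_(i < N) powR (p i * powR (c i) r) (l / (r + l)) = 1) :
  (k%:E <= quant_dim_lower mu r)%E /\
  (quant_dim_lower mu r <= quant_dim_upper mu r)%E /\
  (quant_dim_upper mu r <= l%:E)%E.
Proof.
have [A0 [cA AE]] := hA.
have hc0 i : 0 < c i := lt_le_trans (hs i) (hsc i).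
have hlip i x y := (hbilip i x y).2.
have hexp i x y := (hbilip i x y).1.
(* Since [N >= 2], another index carries positive probability. *)
have p1 i : p i < 1.
  have [j ji] : exists j, j != i.
    apply/existsP; rewrite -negb_forall; apply/negP => /forallP all_i.
    have : (#|'I_N| <= #|pred1 i|)%N by apply/subset_leq_card/fintype.subsetP => j _; exact: all_i.
    by rewrite card_ord card1 leqNgt hN.
  rewrite -hpsum (bigD1 i)//= ltrDl (bigD1 j)//=.
  by rewrite ltr_wpDr// sumr_ge0// => m _; exact: ltW.
have fA i : f i @` A `<=` A by move=> y Ay; rewrite AE; exists i.
have muA : mu A = 1%E.
  exact: (measure_attractor hp hpsum hc0 hc hlip hmu A0 (compact_closed_Rd cA) fA).
have upper := Vnr_upper_bound hp hc0 hlip hmu p1 hc hr hl A0 cA muA hldef.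
have lower k' : 0 < k' -> k' < k -> exists2 C : R, 0 < C &
    forall n, (0 < n)%N -> ((C * n%:R `^ (- (r / k')))%:E <= Vnr mu n r)%E.
  move=> k'0 k'k.
  exact: (ifs_Vnr_lower_bound hp hpsum p1 hs hsc hc hexp hlip hmu hA muA hsosc hr k'0 k'k hkdef).
split; first exact: quant_dim_lower_ge hr _ _ hk hl lower upper.
split; first exact: limn_einf_sup.
apply: quant_dim_upper_le => // n n0.
(* The lower bound at any exponent below [k] shows that the quantization error is positive. *)
have [||C C0 VC] := lower (k / 2); [by lra|by lra|].
by apply: lt_le_trans (VC n n0); rewrite lte_fin mulr_gt0 ?powR_gt0 ?ltr0n.
Qed.
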